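(* Let $\mathbf{K}$ be a field of characteristic $p>2$ and let $(T,\{\cdot,\cdot,\cdot\})$ be a pre-Lie triple system over $\mathbf{K}$. Put $\theta(x,y)(z)=\{z,x,y\}$ for $x,y,z\in T$, and define, for $y\in T$, $$y^{\{p\}}=\theta(y,y)^{\frac{p-1}{2}}(y).$$ Then for all $x,y\in T$ $$(x+y)^{\{p\}}=x^{\{p\}}+y^{\{p\}}+\sum_{i=1}^{p-1}s_i(x,y),$$ where the $s_i(x,y)$ are the coefficients defined in the Lie triple system $(T,[\cdot,\cdot,\cdot]_C)$.
   Context: Pre-Lie triple system: a vector space $A$ with a trilinear map $\{\cdot,\cdot,\cdot\}:A\times A\times A\to A$ such that, with $\{x,y,z\}^{\wedge}=\{z,y,x\}-\{z,x,y\}$ and $[x,y,z]_C=\{x,y,z\}-\{y,x,z\}+\{z,y,x\}-\{z,x,y\}$, the following hold for all $x_1,\dots,x_5\in A$: (1) $\{x_5,x_1,[x_2,x_3,x_4]_C\}=\{\{x_5,x_1,x_2\},x_3,x_4\}-\{\{x_5,x_1,x_3\},x_2,x_4\}+\{x_2,x_3,\{x_5,x_1,x_4\}\}^{\wedge}$; (2) $\{x_1,x_2,\{x_5,x_3,x_4\}\}^{\wedge}=\{\{x_1,x_2,x_5\}^{\wedge},x_3,x_4\}+\{x_5,[x_1,x_2,x_3]_C,x_4\}+\{x_5,x_3,[x_1,x_2,x_4]_C\}$. Known fact: $(A,[\cdot,\cdot,\cdot]_C)$ is then a Lie triple system, i.e. its trilinear bracket satisfies $[x,y,z]=-[y,x,z]$,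 $[x,y,z]+[y,z,x]+[z,x,y]=0$ and $[u,v,[x,y,z]]=[[u,v,x],y,z]+[x,[u,v,y],z]+[x,y,[u,v,z]]$. Coefficients $s_i$: in a Lie triple system with bracket $[\cdot,\cdot,\cdot]$, for odd $n\ge 3$ put $(x_1,\dots,x_n)=[[\cdots[[x_1,x_2,x_3],x_4,x_5],\cdots],x_{n-1},x_n]$. For $1\le i\le p-1$, $s_i(x,y)\in T$ is defined by requiring that $i\,s_i(x,y)$ be the coefficient of $Z^{i-1}$ in the polynomial $(x,Zx+y,\dots,Zx+y)$ in the indeterminate $Z$, where $Zx+y$ occurs $p-1$ times. *)

(* Defs.v *)
From HB Require Import structures.
From mathcomp Require Import all_boot all_order all_algebra.
From mathcomp Require Import zify.

Set Implicit Arguments.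
Unset Strict Implicit.
Unset Printing Implicit Defensive.

Import GRing.Theory.
Local Open Scope ring_scope.

Definition trilinear (K : fieldType) (T : lmodType K)
    (br : T -> T -> T -> T) : Prop :=
  [/\ forall y z, linear (fun x => br x y z),
      forall x z, linear (fun y => br x y z) &
      forall x y, linear (fun z => br x y z)].

Section Brackets.
Variables (K : fieldType) (T : lmodType K) (br : T -> T -> T -> T).

Definition wedge (x y z : T) : T := br z y x - br z x y.

Definition commutator (x y z : T) : T :=
  br x y z - br y x z + br z y x - br z x y.

Definition theta (x y z : T) : T := br z x y.

Definition ppower (p : nat) (y : T) : T := iter p.-1./2 (theta y y) y.

Definition pre_Lie_triple_system : Prop :=
  [/\ trilinear br,
      forall x1 x2 x3 x4 x5 : T,
        br x5 x1 (commutator x2 x3 x4) =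
          br (br x5 x1 x2) x3 x4 - br (br x5 x1 x3) x2 x4
            + wedge x2 x3 (br x5 x1 x4) &
      forall x1 x2 x3 x4 x5 : T,
        wedge x1 x2 (br x5 x3 x4) =
          br (wedge x1 x2 x5) x3 x4 + br x5 (commutator x1 x2 x3) x4
            + br x5 x3 (commutator x1 x2 x4)].

End Brackets.

(* [long_bracket br x1 [:: x2; ...; xn]] is (x1, x2, ..., xn) for n odd; for n
   even the last entry is ignored. *)
Fixpoint long_bracket (X : Type) (br : X -> X -> X -> X) (a : X) (s : seq X) :
    X :=
  if s is b :: c :: s' then long_bracket br (br a b c) s' else a.

Section Coefficients.
Variables (K : fieldType) (T : lmodType K) (br : T -> T -> T -> T).

(* A polynomial in Z with coefficients in T is given by its list of
   coefficients, constant term first; trailing zeros are allowed, and [f`_n] is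
   the coefficient of Z^n. This is the K[Z]-trilinear extension of [br]. *)
Definition Zbracket (f g h : seq T) : seq T :=
  mkseq (fun n => \sum_(i < size f) \sum_(j < size g)
                    \sum_(k < size h | (i + j + k == n)%N) br f`_i g`_j h`_k)
        (size f + size g + size h - 2).

(* The polynomial (x, Zx + y, ..., Zx + y), with p - 1 entries Zx + y. *)
Definition Jacobson_poly (p : nat) (x y : T) : seq T :=
  long_bracket Zbracket [:: x] (nseq p.-1 [:: y; x]).

Definition s_coef (p i : nat) (x y : T) : T :=
  i%:R^-1 *: (Jacobson_poly p x y)`_i.-1.

(* In characteristic p, [s_coef] is the unique solution of the defining
   condition for i in [1, p - 1]. *)
Lemma s_coefP (p i : nat) (x y s : T) :
    p \in [pchar K] -> (0 < i < p)%N ->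
  i%:R *: s = (Jacobson_poly p x y)`_i.-1 <-> s = s_coef p i x y.
Proof.
move=> charp /andP[i_gt0 ltip].
have i_neq0 : i%:R != 0 :> K.
  by rewrite -(dvdn_pcharf charp) gtnNdvd.
rewrite /s_coef; split=> [<-|->]; rewrite scalerA.
  by rewrite mulVf // scale1r.
by rewrite mulfV // scale1r.
Qed.

Lemma coef_Zbracket (f g h : seq T) (n : nat) :
  (Zbracket f g h)`_n =
    \sum_(i < size f) \sum_(j < size g)
      \sum_(k < size h | (i + j + k == n)%N) br f`_i g`_j h`_k.
Proof.
rewrite /Zbracket; have [ltn|len] := ltnP n (size f + size g + size h - 2).
  by rewrite nth_mkseq.
rewrite nth_default ?size_mkseq //; symmetry.
apply: big1 => i _; apply: big1 => j _; apply: big_pred0 => k.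
apply/negbTE/eqP.
by have := ltn_ord i; have := ltn_ord j; have := ltn_ord k; lia.
Qed.

End Coefficients.

(* Main.v *)
(* Let F(Z) = theta(u, u)^((p - 1)/2)(u) with u = Z x + y, a polynomial of
   degree p whose extreme coefficients are y^{p} and x^{p} and whose value at
   Z = 1 is (x + y)^{p}. By the Leibniz rule, F'(Z) is the sum over
   a + b = p - 1 of the words u^a x u^b, where products are read through the
   representation theta and the final factor is applied to a formal vector 1
   with z . 1 = z. On the other hand the identities of a pre-Lie triple system
   say that [x, u, u]_C acts as u u x - 2 u x u + x u u, so that
   (x, u, ..., u) is the sum of the (-1)^a 'C(p - 1, a) u^a x u^b, and
   (-1)^a 'C(p - 1, a) = 1 in characteristic p. Hence
   F'(Z) = (x, u, ..., u), whose coefficients are the i s_i(x, y). *)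
Require Import Defs.
From mathcomp Require Import all_boot all_order all_algebra.
From mathcomp Require Import zify.

Import GRing.Theory.
Local Open Scope ring_scope.

(** * Linearity and trilinearity as predicates on plain functions *)

Section LinearClosure.
Context {K : fieldType} {U V : lmodType K}.

Lemma linear_idfun : linear (fun x : V => x).
Proof. by []. Qed.

Lemma linear_add (f g : U -> V) :
  linear f -> linear g -> linear (fun x => f x + g x).
Proof. by move=> hf hg k a b; rewrite hf hg scalerDr addrACA. Qed.

Lemma linear_opp (f : U -> V) : linear f -> linear (fun x => - f x).
Proof. by move=> hf k a b; rewrite hf opprD scalerN. Qed.

Lemma linear_fun0 {f : U -> V} : linear f -> f 0 = 0.
Proof.
by move=> hf; have := hf (-1) 0 0; rewrite scaler0 addr0 scaleN1r addNr.
Qed.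

Lemma linear_funD {f : U -> V} : linear f -> {morph f : a b / a + b}.
Proof. by move=> hf a b; have := hf 1 a b; rewrite !scale1r. Qed.

Lemma linear_funZ {f : U -> V} (f_lin : linear f) k a : f (k *: a) = k *: f a.
Proof. by have := f_lin k a 0; rewrite linear_fun0 // !addr0. Qed.

Lemma linear_funMn {f : U -> V} (f_lin : linear f) a n : f (a *+ n) = f a *+ n.
Proof. by rewrite -!scaler_nat linear_funZ. Qed.

Lemma linear_funN {f : U -> V} (f_lin : linear f) a : f (- a) = - f a.
Proof. by rewrite -scaleN1r linear_funZ // scaleN1r. Qed.

Lemma linear_fun_sum {f : U -> V} (f_lin : linear f) I r (Q : pred I) F :
  f (\sum_(i <- r | Q i) F i) = \sum_(i <- r | Q i) f (F i).
Proof. by apply: big_morph; [apply: linear_funD|apply: linear_fun0]. Qed.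

End LinearClosure.

Section TrilinearClosure.
Context {K : fieldType} {U V : lmodType K} {br : V -> V -> V -> V}.
Hypothesis br_lin : trilinear br.

Lemma linear_br1 {f : U -> V} y z : linear f -> linear (fun x => br (f x) y z).
Proof. by case: br_lin => h _ _ hf k a b; rewrite hf h. Qed.

Lemma linear_br2 {f : U -> V} y z : linear f -> linear (fun x => br y (f x) z).
Proof. by case: br_lin => _ h _ hf k a b; rewrite hf h. Qed.

Lemma linear_br3 {f : U -> V} y z : linear f -> linear (fun x => br y z (f x)).
Proof. by case: br_lin => _ _ h hf k a b; rewrite hf h. Qed.

End TrilinearClosure.

Lemma linear_br {K : fieldType} {V : lmodType K} {br : V -> V -> V -> V} y z :
  trilinear br -> linear (br y z).
Proof. by case. Qed.

Ltac prove_linear := rewrite /commutator /wedge;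
  repeat first [exact: linear_idfun | by apply: linear_br
   | apply: linear_add | apply: linear_opp
   | apply: linear_br1; [by []|] | apply: linear_br2; [by []|]
   | apply: linear_br3; [by []|]].

Lemma trilinear_commutator {K : fieldType} {T : lmodType K}
    {br : T -> T -> T -> T} : trilinear br -> trilinear (commutator br).
Proof. by move=> br_lin; split=> a b; prove_linear. Qed.

Lemma trilinear_wedge {K : fieldType} {T : lmodType K}
    {br : T -> T -> T -> T} : trilinear br -> trilinear (wedge br).
Proof. by move=> br_lin; split=> a b; prove_linear. Qed.

(** * Words in [u] with one other letter [x], and the action of [R x] on them *)

Section Words.
Context {K : fieldType} {V : lmodType K} (br : V -> V -> V -> V).
Hypothesis brP : pre_Lie_triple_system br.
Variable u : V.

Let br_lin : trilinear br. Proof. by case: brP. Qed.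
Let P := theta br u u.
Let R x := commutator br x u u.

(* The value u^a x u^b . 1, for a + b even, where theta(x, y) stands for the
   product yx and z . 1 stands for z; junk for a + b odd. *)
Definition word (a b : nat) (x : V) : V :=
  iter a./2 P
    (if b is b'.+1 then
       if odd b then br (iter b'./2 P u) x u else br (iter b'./2 P u) u x
     else x).

Let P_lin : linear P.
Proof. exact: (linear_br1 br_lin u u linear_idfun). Qed.

Let iterP_lin n : linear (iter n P).
Proof. by elim: n => [|n IHn] k a b //=; rewrite IHn P_lin. Qed.

(** Identity (1) with x2 = [x], x5 = [v] and all other entries [u]. As words: (R x)uv = uuxuv - 2
    uxuuv + xuuuv. *)
Lemma br_commutator_right v x :
  br v u (R x) = P (br v u x) - (br (P v) x u) *+ 2 + br (P v) u x.
Proof.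
case: brP => _ h1 _; rewrite /R h1 /wedge /P /theta mulr2n opprD.
by rewrite (AC (2*2) (1*(2*4)*3))%AC.
Qed.

(** Identity (2) with x1 = [x], x5 = [v] and all other entries [u] contains both [br v (R x) u] and
    [br v u (R x)]; [br_commutator_right] eliminates the latter. *)
Lemma br_commutator_left v x :
  br v (R x) u = br (P v) x u - P (br v u x) *+ 2 + P (br v x u).
Proof.
case: brP => _ _ h2; have := h2 x u u u v.
rewrite -/(R x) br_commutator_right /wedge -/(P _).
rewrite -[br (_ - _) u u]/(P _) (linear_funD P_lin) (linear_funN P_lin).
rewrite -[br v u u]/(P v).
set A := br (P v) u x; set B := br (P v) x u; set C := P _; set D := P _.
(* The added terms are the two other summands on the right of identity (2). *)
move=> h; apply: (addrI (C - D)); apply: (addIr (C - B *+ 2 + A)).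
rewrite -h !mulr2n !opprD !addrA.
rewrite (ACl (10*9*(1*4)*(7*5)*(2*6)*(3*8)))%AC /=.
by rewrite !subrr addNr !addr0.
Qed.

(** [R x] acts as uux - 2 uxu + xuu. For b = 0 this is the definition of [commutator]; for b > 0
    even it is [br_commutator_right], for b odd [br_commutator_left]. *)
Lemma word_commutator a b x : ~~ odd (a + b) ->
  word a b (R x) = word a b.+2 x - word a.+1 b.+1 x *+ 2 + word a.+2 b x.
Proof.
have PE n v w z : iter n P (v - w *+ 2 + z) =
    iter n P v - iter n P w *+ 2 + iter n P z.
  rewrite !(linear_funD (iterP_lin n)) (linear_funN (iterP_lin n)).
  by rewrite !mulr2n (linear_funD (iterP_lin n)).
have RE : R x = br u u x - br u x u *+ 2 + P x.
  rewrite /R /commutator mulr2n opprD -/(P x).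
  by rewrite (ACl (3*(2*4)*1))%AC.
have uphalfE m : uphalf m = (odd m + m./2)%N by rewrite uphalf_half.
rewrite oddD; case: b => [|b]; rewrite /word.
  rewrite /= addbF uphalfE => /negPf ->.
  by rewrite RE PE -iterSr.
rewrite /= !negbK !uphalfE; case: (odd b) => /=; case: (odd a) => //= _.
  by rewrite br_commutator_right PE -!iterSr (ACl (3*2*1))%AC.
by rewrite br_commutator_left PE -!iterSr (ACl (3*2*1))%AC.
Qed.

(** This is (S - S')^n W at (0, 0), where S raises the second index of W by one and S' the first. *)
Definition antidiagonal_sum n (W : nat -> nat -> V) : V :=
  \sum_(j < n.+1) ((-1) ^+ j * 'C(n, j)%:R : K) *: W j (n - j)%N.

(** Pascal's rule. *)
Lemma antidiagonal_sumS n (W : nat -> nat -> V) :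
  antidiagonal_sum n.+1 W =
    antidiagonal_sum n (fun a b => W a b.+1 - W a.+1 b).
Proof.
pose c m j : K := (-1) ^+ j * 'C(m, j)%:R.
have cS j : c n.+1 j.+1 = c n j.+1 - c n j.
  by rewrite /c binS natrD mulrDr exprS !mulN1r !mulNr.
rewrite /antidiagonal_sum big_ord_recl /=.
rewrite (eq_bigr _ (fun (j : 'I_n.+1) _ => congr1 (fun k => k *: _) (cS j))).
rewrite (eq_bigr _ (fun j _ => scalerBl _ _ _)) sumrB big_ord_recr /=.
have -> : c n n.+1 = 0 by rewrite /c bin_small // mulr0.
rewrite scale0r addr0 addrA.
rewrite [RHS](eq_bigr _ (fun j _ => scalerBr _ _ _)) sumrB.
congr (_ - _).
by rewrite [RHS]big_ord_recl !bin0 !subn0; congr (_ + _); apply: eq_bigr => j _;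
   rewrite /c lift0 subSS subnSK.
Qed.

(** By [word_commutator], one [R] is a second difference of words, hence two uses of
    [antidiagonal_sumS]. *)
Lemma iter_commutator n x :
  iter n R x = antidiagonal_sum n.*2 (fun a b => word a b x).
Proof.
elim: n x => [|n IHn] x.
  by rewrite /antidiagonal_sum big_ord1 bin0 mulr1 scale1r.
rewrite iterSr IHn doubleS !antidiagonal_sumS.
apply: eq_bigr => j _; congr (_ *: _); rewrite word_commutator.
  by rewrite opprB addrA mulr2n opprD !addrA addrAC.
by rewrite subnKC ?odd_double // -ltnS ltn_ord.
Qed.


Section Characteristic.
Variable p : nat.
Hypothesis charp : p \in [pchar K].

(** As 'C(p, j + 1) vanishes in [K], Pascal's rule makes consecutive 'C(p - 1, j) opposite. *)
Lemma signed_bin_pchar j : (j < p)%N -> (-1) ^+ j * 'C(p.-1, j)%:R = 1 :> K.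
Proof.
have p_pr := pcharf_prime charp; have p_gt0 := prime_gt0 p_pr.
elim: j => [|j IHj] ltjp; first by rewrite bin0 mulr1.
have := bin_lt_pcharf_0 charp (ltjp : 0 < j.+1 < p)%N.
rewrite -[in 'C(p, _)](prednK p_gt0) binS natrD => /eqP; rewrite addr_eq0.
by move=> /eqP->; rewrite exprS mulN1r mulrNN IHj // ltnW.
Qed.

Lemma iter_commutator_pchar n x : n.*2 = p.-1 ->
  iter n R x = \sum_(j < p) word j (p.-1 - j) x.
Proof.
move=> def_n; have p_gt0 := prime_gt0 (pcharf_prime charp).
rewrite iter_commutator def_n /antidiagonal_sum prednK //.
by apply: eq_bigr => j _; rewrite signed_bin_pchar ?scale1r.
Qed.

End Characteristic.

(** Leibniz rule on the outermost [P]: its two letters [u] give the words j = 0 and j = 1, and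
    prefixing [P] to the inner words raises their j by 2. *)
Lemma derivation_iter_theta (E : V -> V) n :
    (forall x y z, E (br x y z) = br (E x) y z + br x (E y) z + br x y (E z)) ->
  E (iter n P u) = \sum_(j < n.*2.+1) word j (n.*2 - j) (E u).
Proof.
move=> E_der; elim: n => [|n IHn]; first by rewrite big_ord1.
rewrite iterS E_der IHn doubleS -[br _ u u]/(P _) (linear_fun_sum P_lin).
rewrite [RHS]big_ord_recl [X in _ = _ + X]big_ord_recl [LHS](ACl (3*(2*1)))%AC.
congr (_ + (_ + _)).
  by rewrite /word subn0 /= odd_double uphalf_double.
by rewrite /word lift0 subSS subn0 /= odd_double doubleK.
Qed.

End Words.

(** * The pre-Lie triple system T[Z] / (Z^N) *)

Section TruncatedPolynomials.
Context {K : fieldType} {T : lmodType K} {N : nat}.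

(* T[Z] / (Z^N), of which [monom i a] is the element a Z^i. *)
Local Notation V := {ffun 'I_N -> T}.

Definition monom (i : nat) (a : T) : V :=
  [ffun n : 'I_N => if n == i :> nat then a else 0].

Lemma linear_monom i : linear (monom i).
Proof.
move=> k a b; apply/ffunP => n; rewrite !ffunE.
by case: eqP; rewrite ?scaler0 ?addr0.
Qed.

Lemma monom_default i a : (N <= i)%N -> monom i a = 0.
Proof.
move=> leNi; apply/ffunP => n; rewrite !ffunE.
by rewrite ltn_eqF // (leq_trans (ltn_ord n)).
Qed.

Lemma sum_monom (f : V) : f = \sum_(i < N) monom i (f i).
Proof.
apply/ffunP => n; rewrite sum_ffunE (bigD1 n) //= ffunE eqxx.
rewrite big1 ?addr0 // => i.
by rewrite ffunE eq_sym => /negPf; rewrite -val_eqE /= => ->.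
Qed.

Lemma linear_monom_ext (f g : V -> V) : linear f -> linear g ->
  (forall i a, f (monom i a) = g (monom i a)) -> f =1 g.
Proof.
move=> f_lin g_lin fg v; rewrite [v]sum_monom (linear_fun_sum f_lin).
by rewrite (linear_fun_sum g_lin); apply: eq_bigr.
Qed.

Lemma trilinear_monom_ext (f g : V -> V -> V -> V) :
    trilinear f -> trilinear g ->
    (forall i a j b k c, f (monom i a) (monom j b) (monom k c) =
                         g (monom i a) (monom j b) (monom k c)) ->
  forall x y z, f x y z = g x y z.
Proof.
move=> [f1 f2 f3] [g1 g2 g3] fg x y z.
move: x; apply: linear_monom_ext => // i a.
move: y; apply: linear_monom_ext => // j b.
by move: z; apply: linear_monom_ext.
Qed.

Lemma linear_monom_sum (F : nat -> T -> V) :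
  (forall i, linear (F i)) -> linear (fun f : V => \sum_(i < N) F i (f i)).
Proof.
move=> F_lin k f g; rewrite scaler_sumr -big_split; apply: eq_bigr => i _.
by rewrite !ffunE F_lin.
Qed.

(** Covers [N <= i], where both sides vanish, so that computations on monomials need no bound on
    exponents. *)
Lemma monom_sum (F : nat -> T -> V) i a :
    (forall i, linear (F i)) -> (forall i a, (N <= i)%N -> F i a = 0) ->
  \sum_(j < N) F j (monom i a j) = F i a.
Proof.
move=> F_lin F_default; have [ltiN|leNi] := ltnP i N; last first.
  rewrite F_default // big1 // => j _.
  by rewrite monom_default // ffunE (linear_fun0 (F_lin j)).
rewrite (bigD1 (Ordinal ltiN)) //= ffunE eqxx big1 ?addr0 // => j.
by rewrite -val_eqE /= ffunE => /negPf ->; rewrite (linear_fun0 (F_lin j)).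
Qed.

(** Multiplication by Z; the top coefficient is lost because [monom N] is zero. *)
Definition shift (f : V) : V := \sum_(i < N) monom i.+1 (f i).

Lemma linear_shift : linear shift.
Proof.
by apply: (linear_monom_sum (fun i => monom i.+1)) => i; apply: linear_monom.
Qed.

Lemma shift_monom i a : shift (monom i a) = monom i.+1 a.
Proof.
apply: (monom_sum (fun i => monom i.+1)) => j; first exact: linear_monom.
by move=> b leNj; rewrite monom_default // leqW.
Qed.

Lemma coef_shift (f : V) (n m : 'I_N) : n = m.+1 :> nat -> shift f n = f m.
Proof.
move=> nm; rewrite sum_ffunE (bigD1 m) //= ffunE nm eqxx big1 ?addr0 // => i.
by rewrite ffunE nm eqSS eq_sym -val_eqE => /negPf /= ->.
Qed.

(** The operator Z d/dZ; unlike d/dZ, it preserves the ideal (Z^N) for every N. *)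
Definition Euler (f : V) : V := [ffun n => f n *+ n].

Lemma linear_Euler : linear Euler.
Proof. by move=> k f g; apply/ffunP => n; rewrite !ffunE mulrnDl scalerMnr. Qed.

Lemma Euler_monom i a : Euler (monom i a) = monom i a *+ i.
Proof.
apply/ffunP => n; rewrite ffunMnE !ffunE; case: eqP => [->|_] //.
by rewrite !mul0rn.
Qed.

Definition monom_br (br : T -> T -> T -> T) (f g h : V) : V :=
  \sum_(i < N) \sum_(j < N) \sum_(k < N)
    monom (i + j + k) (br (f i) (g j) (h k)).

Lemma trilinear_monom_br {br : T -> T -> T -> T} :
  trilinear br -> trilinear (monom_br br).
Proof.
case=> h1 h2 h3; split=> x y l f g; rewrite /monom_br.
all: rewrite scaler_sumr -big_split; apply: eq_bigr => i _.
all: rewrite scaler_sumr -big_split; apply: eq_bigr => j _.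
all: rewrite scaler_sumr -big_split; apply: eq_bigr => k _.
all: by rewrite !ffunE (h1, h2, h3) linear_monom.
Qed.

Lemma monom_brE {br : T -> T -> T -> T} (br_lin : trilinear br) i j k a b c :
  monom_br br (monom i a) (monom j b) (monom k c) =
    monom (i + j + k) (br a b c).
Proof.
have F_lin f n : linear f -> linear (fun d : T => monom n (f d : T)).
  by move=> f_lin l d e; rewrite f_lin linear_monom.
(* The right-hand side is expanded into the triple sum one argument at a time, by [monom_sum]. *)
pose F1 i a := monom (i + j + k) (br a b c).
rewrite -[RHS]/(F1 i a) -(monom_sum F1) /F1 => [|i'|i' a' leN]; first 1 last.
- by apply: (F_lin _ _ (linear_br1 br_lin _ _ linear_idfun)).
- by rewrite monom_default ?(leq_trans leN) // -addnA leq_addr.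
apply: eq_bigr => i' _; move: (monom i a i') => a'.
pose F2 j b := monom (i' + j + k) (br a' b c).
rewrite -[RHS]/(F2 j b) -(monom_sum F2) /F2 => [|j'|j' b' leN]; first 1 last.
- by apply: (F_lin _ _ (linear_br2 br_lin _ _ linear_idfun)).
- by rewrite monom_default ?(leq_trans leN) // ?(addnAC, leq_addl) ?leq_addl.
apply: eq_bigr => j' _; move: (monom j b j') => b'.
apply: (monom_sum (fun k c => monom (i' + j' + k) (br a' b' c)))
  => [k'|k' c' leN].
  by apply: (F_lin _ _ (linear_br3 br_lin _ _ linear_idfun)).
by rewrite monom_default // (leq_trans leN) // ?(addnAC, leq_addl) ?leq_addl.
Qed.

Lemma monomD m n a b : m = n -> monom m a + monom n b = monom m (a + b).
Proof. by move=> <-; rewrite (linear_funD (linear_monom m)). Qed.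

Lemma monomB m n a b : m = n -> monom m a - monom n b = monom m (a - b).
Proof. by move=> <-; rewrite -(linear_funN (linear_monom m)) monomD. Qed.

Lemma wedge_monom_br {br : T -> T -> T -> T} : trilinear br ->
  forall f g h, wedge (monom_br br) f g h = monom_br (wedge br) f g h.
Proof.
move=> br_lin; have B_lin := trilinear_monom_br br_lin.
have W_lin := trilinear_wedge br_lin.
apply: trilinear_monom_ext; [exact: trilinear_wedge|exact: trilinear_monom_br|].
move=> i a j b k c; rewrite (monom_brE W_lin) /wedge !(monom_brE br_lin).
by rewrite monomB; [congr monom|]; lia.
Qed.

Lemma commutator_monom_br {br : T -> T -> T -> T} : trilinear br ->
  forall f g h,
    commutator (monom_br br) f g h = monom_br (commutator br) f g h.
Proof.
move=> br_lin; have B_lin := trilinear_monom_br br_lin.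
have C_lin := trilinear_commutator br_lin.
apply: trilinear_monom_ext;
  [exact: trilinear_commutator|exact: trilinear_monom_br|].
move=> i a j b k c; rewrite (monom_brE C_lin) /commutator !(monom_brE br_lin).
by rewrite monomB ?monomD ?monomB //; lia.
Qed.

Ltac monom_ext x :=
  move: x;
  match goal with |- forall x, @?f x = @?g x =>
    apply: (linear_monom_ext f g); [prove_linear..|cbv beta]
  end.

(** Both identities are linear in each variable, so monomials suffice; there all terms have the same
    exponent and the identities of [br] apply. *)
Lemma pre_Lie_monom_br (br : T -> T -> T -> T) :
  pre_Lie_triple_system br -> pre_Lie_triple_system (monom_br br).
Proof.
case=> br_lin h1 h2; have B_lin := trilinear_monom_br br_lin.
have W_lin := trilinear_wedge br_lin; have C_lin := trilinear_commutator br_lin.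
split=> // x1 x2 x3 x4 x5.
- monom_ext x1; move=> i1 a1.
  monom_ext x2; move=> i2 a2.
  monom_ext x3; move=> i3 a3.
  monom_ext x4; move=> i4 a4.
  monom_ext x5; move=> i5 a5.
  rewrite !(commutator_monom_br br_lin, wedge_monom_br br_lin).
  rewrite !(monom_brE br_lin, monom_brE W_lin, monom_brE C_lin) h1.
  by rewrite monomB ?monomD //; [congr monom|..]; lia.
monom_ext x1; move=> i1 a1.
monom_ext x2; move=> i2 a2.
monom_ext x3; move=> i3 a3.
monom_ext x4; move=> i4 a4.
monom_ext x5; move=> i5 a5.
rewrite !(commutator_monom_br br_lin, wedge_monom_br br_lin).
rewrite !(monom_brE br_lin, monom_brE W_lin, monom_brE C_lin) h2.
by rewrite !monomD //; [congr monom|..]; lia.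
Qed.

Lemma monom_br_shift {br : T -> T -> T -> T} : trilinear br ->
  forall f g h, monom_br br (shift f) g h = shift (monom_br br f g h).
Proof.
move=> br_lin; have [h1 h2 h3] := trilinear_monom_br br_lin.
apply: trilinear_monom_ext.
- by split=> // y z k a b; rewrite linear_shift h1.
- by split=> y z k a b; rewrite (h1, h2, h3) linear_shift.
by move=> *; rewrite shift_monom !(monom_brE br_lin) shift_monom !addSn.
Qed.

(** On monomials this says that exponents add up. *)
Lemma Euler_monom_br {br : T -> T -> T -> T} : trilinear br ->
  forall f g h, Euler (monom_br br f g h) =
    monom_br br (Euler f) g h + monom_br br f (Euler g) h
      + monom_br br f g (Euler h).
Proof.
move=> br_lin; have B_lin := trilinear_monom_br br_lin.
have E_lin f : linear f -> linear (fun x : V => Euler (f x)).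
  by move=> f_lin k a b; rewrite f_lin linear_Euler.
have Euler_lin := linear_Euler.
apply: trilinear_monom_ext.
- by split=> y z; apply: E_lin; prove_linear.
- by split=> y z; prove_linear.
move=> i a j b k c; rewrite (monom_brE br_lin) !Euler_monom.
have [B1 B2 B3] := B_lin.
rewrite (linear_funMn (B1 _ _)) (linear_funMn (B2 _ _)).
by rewrite (linear_funMn (B3 _ _)) !(monom_brE br_lin) -!mulrnDr.
Qed.

(** Reduction modulo Z^N of a polynomial given by its coefficients. *)
Definition coefs (s : seq T) : V := [ffun n : 'I_N => s`_n].

Lemma coefs_sum s : coefs s = \sum_(i < size s) monom i s`_i.
Proof.
apply/ffunP => n; rewrite sum_ffunE ffunE.
have [ltns|lesn] := ltnP n (size s); last first.
  rewrite nth_default // big1 // => i _; rewrite ffunE gtn_eqF //.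
  exact: leq_trans (ltn_ord i) lesn.
rewrite (bigD1 (Ordinal ltns)) //= ffunE eqxx big1 ?addr0 // => i.
by rewrite ffunE -val_eqE eq_sym /= => /negPf->.
Qed.

Lemma coefs_Zbracket {br : T -> T -> T -> T} : trilinear br ->
  forall f g h,
    coefs (Zbracket br f g h) = monom_br br (coefs f) (coefs g) (coefs h).
Proof.
move=> br_lin f g h; have [B1 B2 B3] := trilinear_monom_br br_lin.
rewrite (coefs_sum f) (coefs_sum g) (coefs_sum h) (linear_fun_sum (B1 _ _)).
apply/ffunP => n; rewrite ffunE coef_Zbracket sum_ffunE; apply: eq_bigr => i _.
rewrite (linear_fun_sum (B2 _ _)) sum_ffunE; apply: eq_bigr => j _.
rewrite (linear_fun_sum (B3 _ _)) sum_ffunE big_mkcond; apply: eq_bigr => k _.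
by rewrite (monom_brE br_lin) ffunE eq_sym.
Qed.

End TruncatedPolynomials.

(** * Extreme coefficients of a bracket of polynomials, and its value at Z = 1 *)

Section Zbracket.
Context {K : fieldType} {T : lmodType K} (br : T -> T -> T -> T).

Lemma size_Zbracket f g h :
  size (Zbracket br f g h) = (size f + size g + size h - 2)%N.
Proof. by rewrite size_mkseq. Qed.

(** Meant for constant and top coefficients, to which a single triple of exponents contributes. *)
Lemma coef_Zbracket_unique f g h i0 j0 k0 :
    (i0 < size f)%N -> (j0 < size g)%N -> (k0 < size h)%N ->
    (forall i j k, (i < size f)%N -> (j < size g)%N -> (k < size h)%N ->
      (i + j + k = i0 + j0 + k0)%N -> [/\ i = i0, j = j0 & k = k0]) ->
  (Zbracket br f g h)`_(i0 + j0 + k0) = br f`_i0 g`_j0 h`_k0.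
Proof.
move=> ltif ltjg ltkh uniq; rewrite coef_Zbracket.
rewrite (bigD1 (Ordinal ltif)) //= (bigD1 (Ordinal ltjg)) //=.
rewrite (big_pred1 (Ordinal ltkh)) => [|k]; last by rewrite eqn_add2l.
rewrite big1 => [|j neqj]; first rewrite big1 ?addr0 // => i neqi.
  apply: big1 => j _; apply: big1 => k /eqP eq_ijk; case/eqP: neqi.
  by apply: val_inj; have [] :=
    uniq i j k (ltn_ord _) (ltn_ord _) (ltn_ord _) eq_ijk.
apply: big1 => k /eqP eq_ijk; case/eqP: neqj.
by apply: val_inj; have [] := uniq _ j k ltif (ltn_ord _) (ltn_ord _) eq_ijk.
Qed.

Lemma sum_Zbracket f g h : trilinear br ->
  \sum_(i < size (Zbracket br f g h)) (Zbracket br f g h)`_i =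
    br (\sum_(i < size f) f`_i) (\sum_(i < size g) g`_i)
      (\sum_(i < size h) h`_i).
Proof.
move=> br_lin; have [h1 h2 h3] := br_lin.
rewrite (linear_fun_sum (h1 _ _)) size_Zbracket.
under eq_bigr => n _ do rewrite coef_Zbracket.
rewrite exchange_big; apply: eq_bigr => i _.
rewrite exchange_big (linear_fun_sum (h2 _ _)); apply: eq_bigr => j _.
under eq_bigr => n _ do rewrite big_mkcond.
rewrite exchange_big (linear_fun_sum (h3 _ _)); apply: eq_bigr => k _.
(* Each triple contributes to exactly one n, and the list is long enough to contain it. *)
have ltn : (i + j + k < size f + size g + size h - 2)%N.
  by have := ltn_ord i; have := ltn_ord j; have := ltn_ord k; lia.
by rewrite -big_mkcond (big_pred1 (Ordinal ltn)) // => n; rewrite eq_sym.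
Qed.

End Zbracket.

(** * The polynomial F(Z) and its derivative *)

Section PthPower.
Context {K : fieldType} {T : lmodType K} (br : T -> T -> T -> T).
Variables x y : T.
Let u := [:: y; x].

(* The polynomial theta(u, u)^n (u), for u = Z x + y. *)
Definition theta_poly n : seq T := iter n (fun f => Zbracket br f u u) u.

Lemma size_theta_poly n : size (theta_poly n) = n.*2.+2.
Proof.
elim: n => // n IHn.
by rewrite /= size_Zbracket -/(theta_poly n) IHn /=; lia.
Qed.

Lemma sum_theta_poly n : trilinear br ->
  \sum_(i < n.*2.+2) (theta_poly n)`_i =
    iter n (theta br (x + y) (x + y)) (x + y).
Proof.
move=> br_lin; rewrite -size_theta_poly.
have sum_u : \sum_(i < size u) u`_i = x + y
  by rewrite big_ord_recl big_ord1 addrC.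
by elim: n => [|n IHn] //=; rewrite sum_Zbracket // IHn sum_u.
Qed.

Lemma theta_poly0 n : (theta_poly n)`_0 = iter n (theta br y y) y.
Proof.
elim: n => // n IHn.
rewrite iterS -IHn (coef_Zbracket_unique br (theta_poly n) u u 0 0 0) //.
  by rewrite size_theta_poly.
by move=> i j k _ _ _ ?; split; lia.
Qed.

Lemma lead_theta_poly n : (theta_poly n)`_n.*2.+1 = iter n (theta br x x) x.
Proof.
elim: n => // n IHn; rewrite iterS -IHn.
(* These are the largest exponents of the three factors, so their sum is reached only once. *)
have := coef_Zbracket_unique br (theta_poly n) u u n.*2.+1 1 1.
rewrite size_theta_poly doubleS !addn1 => -> //.
by move=> i j k /= *; split; lia.
Qed.

Lemma coefs_theta_poly N n : trilinear br ->
  coefs (theta_poly n) =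
    iter n (theta (monom_br br) (coefs u) (coefs u)) (coefs u)
      :> {ffun 'I_N -> T}.
Proof.
by move=> br_lin; elim: n => //= n IHn; rewrite coefs_Zbracket // IHn.
Qed.

Lemma coefs_Jacobson_poly N p n : trilinear br -> p.-1 = n.*2 ->
  coefs (Jacobson_poly (commutator br) p x y) =
    iter n (fun v => commutator (monom_br br) v (coefs u) (coefs u))
      (coefs [:: x]) :> {ffun 'I_N -> T}.
Proof.
(* [long_bracket] accumulates in its first argument, so the induction needs an arbitrary start
   [s]. *)
move=> br_lin; rewrite /Jacobson_poly -/u => ->; move: u [:: x] => v s.
elim: n s => // n IHn s; rewrite doubleS iterSr /= IHn.
rewrite coefs_Zbracket ?commutator_monom_br //.
exact: trilinear_commutator.
Qed.

(* The Euler operator sends Z x + y to Z x, so that it multiplies the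
   coefficient of Z^i by i on the left, and gives Z times the Jacobson
   polynomial on the right. *)
Lemma Euler_theta_poly p n : pre_Lie_triple_system br ->
    p \in [pchar K] -> p.-1 = n.*2 ->
  Euler (coefs (theta_poly n)) =
    shift (coefs (Jacobson_poly (commutator br) p x y)) :> {ffun 'I_p -> T}.
Proof.
move=> brP charp def_n; have [br_lin _ _] := brP.
(* The factor Z moves inside the iterated commutator, down to its initial entry [x]. *)
have shift_R m v :
    shift (iter m (fun v => commutator (monom_br br) v (coefs u) (coefs u)) v) =
    iter m (fun v => commutator (monom_br br) v (coefs u) (coefs u)) (shift v)
      :> {ffun 'I_p -> T}.
  elim: m => //= m <-; rewrite !commutator_monom_br ?monom_br_shift //.
  exact: trilinear_commutator.
have Euler_u : Euler (coefs u) = shift (coefs [:: x]) :> {ffun 'I_p -> T}.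
  rewrite !coefs_sum /= big_ord1 /= shift_monom (linear_fun_sum linear_Euler).
  by rewrite !big_ord_recl big_ord0 /= !Euler_monom mulr0n add0r addr0.
have B_pl : pre_Lie_triple_system (@monom_br K T p br)
  by apply: pre_Lie_monom_br.
rewrite (coefs_Jacobson_poly p p n) // shift_R coefs_theta_poly //.
(* Both sides become the sum over j < p of the words [word j (p.-1 - j)] at Z x. *)
rewrite (iter_commutator_pchar _ B_pl _ p charp n) //.
rewrite (derivation_iter_theta _ B_pl _ Euler n (Euler_monom_br br_lin)).
by rewrite Euler_u -def_n prednK // (prime_gt0 (pcharf_prime charp)).
Qed.

End PthPower.

Theorem theorem5p17 (K : fieldType) (p : nat) (T : lmodType K)
    (br : T -> T -> T -> T) :
  p \in [pchar K] -> (2 < p)%N -> pre_Lie_triple_system br ->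
  forall x y : T,
    ppower br p (x + y) =
      ppower br p x + ppower br p y
        + \sum_(1 <= i < p) s_coef (commutator br) p i x y.
Proof.
move=> charp p_gt2 brP x y; have [br_lin _ _] := brP.
have p_gt0 : (0 < p)%N by apply: ltnW (ltnW p_gt2).
have p_odd : odd p.
  by have [p2|//] := even_prime (pcharf_prime charp); rewrite p2 in p_gt2.
pose n := p.-1./2; have def_n : p.-1 = n.*2.
  by rewrite even_halfK // -oddS prednK.
(* The three p-powers become the sum of all coefficients of [theta_poly], its constant term and its
   coefficient of Z^p; the exponents 0 < i < p remain. *)
rewrite /ppower -/n -sum_theta_poly // -(theta_poly0 br x y).
rewrite -(lead_theta_poly br x y) -def_n prednK //.
rewrite -(big_mkord xpredT (fun i => (theta_poly br x y n)`_i)).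
rewrite big_nat_recr //= big_ltn // -addrA [X in _ + X = _]addrC addrA.
congr (_ + _); first by rewrite addrC.
apply: eq_big_nat => i /andP[i_gt0 ltip].
have ltip' : (i.-1 < p)%N by rewrite prednK // ltnW.
(* The condition defining [s_coef] is the coefficient of Z^i in [Euler_theta_poly]; the shift by Z
   accounts for the index i - 1. *)
apply/s_coefP; rewrite ?i_gt0 //.
have := Euler_theta_poly br x y p n brP charp def_n.
move=> /ffunP/(_ (Ordinal ltip)).
by rewrite (coef_shift _ _ (Ordinal ltip')) ?ffunE /= ?prednK // scaler_nat.
Qed.
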